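(* Let $(N,G)$ be a nearly ordered permutation group having a nonidentity bounded element. (1) In the linear and monotonic cases: (a) if $(N,G)$ is 3-interval-transitive then it is highly approximately $o$-transitive; (b) if $N$ is Dedekind complete and $(N,G)$ is approximately 2-$o$-transitive, then it is highly approximately $o$-transitive. (2) In the circular and monocircular cases: (a) if $(N,G)$ is 4-interval-transitive then it is highly approximately $o$-transitive; (b) if $N$ is Dedekind complete and $(N,G)$ is approximately 3-$o$-transitive, then it is highly approximately $o$-transitive.
   Context: Let $L$ be a dense linear order. A nearly ordered permutation group $(N,G)$, $G\le\mathrm{Aut}(N)$, is of one of four types: linear ($N=(L,<)$, $L$ without endpoints, order-preserving bijections), monotonic ($N=\mathrm{ED}(L)$, $L$ without endpoints, automorphisms = order-preserving or order-reversing bijections of $L$), circular ($N=(L,\mathrm{Cr})$, $L$ with at most one endpoint, $\mathrm{Cr}(x,y,z)$ iff $x<y<z$ or $y<z<x$ or $z<x<y$, automorphisms = $\mathrm{Cr}$-preserving bijections), monocircular ($N=\mathrm{EO}(L)$, automorphisms = bijections preserving or reversing $\mathrm{Cr}$). $\bar N$ is the Dedekind completion of the same type ($\bar L$, no endpoints added, in linear/monotonic cases; $\bar L$ with one endpoint adjoined if none, circularized, in circular cases); $N$ is Dedekind complete if $N=\bar N$. Elements of $G$ extend uniquely to $\bar N$; $\mathrm{supp}(g)=\{x\in\bar N:g(x)\ne x\}$; $g$ is bounded if $\mathrm{supp}(g)$ lies in a bounded $\bar N$-interval. Bounded intervals: $(x,y)$ with $x<y$ (linear/monotonic), $(x,y)=\{z:\mathrm{Cr}(x,z,y)\}$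 with $x\ne y$ (circular); $N$-intervals also include rays and $L$ (linear/monotonic), and the whole circle and the circle minus a point (circular). Circular notation: $\mathrm{Cr}(x_1,\ldots,x_n)$ iff $\mathrm{Cr}(x_i,x_j,x_k)$ for all $i<j<k$ (for $n=2$: $x_1\ne x_2$; $n=1$: always true); $\mathrm{Crs}(I_1,\ldots,I_n)$ iff each $I_k\ne\emptyset$ and $\mathrm{Cr}(x_1,\ldots,x_n)$ whenever $x_k\in I_k$ (for $n=2$: disjoint; $n=1$: always). In the linear/monotonic case (using the order of $L$): $(N,G)$ is $n$-interval-transitive if for all $N$-intervals $I_1<\dots<I_n$, $J_1<\dots<J_n$ some $g\in G$ has $g(I_k)\cap J_k\ne\emptyset$ for all $k$; approximately $n$-$o$-transitive if for all $a_1<\dots<a_n$ in $L$ and $L$-intervals $I_1<\dots<I_n$ some $g\in G$ has $g(a_k)\in I_k$ for all $k$. In the circular/monocircular case the same, with $<$-chains replaced by $\mathrm{Cr}(a_1,\ldots,a_n)$ and $\mathrm{Crs}(\ldots)$. ''Highly'' means for all $n\ge1$. *)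

(* Defs.v *)
From HB Require Import structures.
From mathcomp Require Import all_boot all_order.
From mathcomp Require Import boolp classical_sets.
Set Implicit Arguments.
Unset Strict Implicit.
Unset Printing Implicit Defensive.
Import Order.TTheory.
Local Open Scope classical_set_scope.
Local Open Scope order_scope.

Inductive kind := Linear | Monotonic | Circular | Monocircular.

Definition circ (k : kind) : bool :=
  match k with Linear | Monotonic => false | Circular | Monocircular => true end.

Section OnAnOrder.
Context {d : Order.disp_t} {T : orderType d}.

Definition dense_order := forall x y : T, x < y -> exists z, x < z < y.

Definition endpoint (x : T) := (forall y, x <= y) \/ (forall y, y <= x).

Definition Cr (x y z : T) : bool := [|| x < y < z, y < z < x | z < x < y].

Definition automorphism (k : kind) (f : T -> T) : Prop :=
  bijective f /\
  match k with
  | Linear => {mono f : x y / x < y}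
  | Monotonic => {mono f : x y / x < y} \/ {mono f : x y /~ x < y}
  | Circular => forall x y z, Cr (f x) (f y) (f z) = Cr x y z
  | Monocircular =>
      (forall x y z, Cr (f x) (f y) (f z) = Cr x y z) \/
      (forall x y z, Cr (f z) (f y) (f x) = Cr x y z)
  end.

Definition bounded_interval (k : kind) (I : set T) : Prop :=
  if circ k then exists x y, x <> y /\ I = [set z | Cr x z y]
  else exists x y, x < y /\ I = [set z | x < z < y].

Definition N_interval (k : kind) (I : set T) : Prop :=
  bounded_interval k I \/ I = setT \/
  (if circ k then exists x, I = [set z | z <> x]
   else exists x, I = [set z | x < z] \/ I = [set z | z < x]).

(* For n >= 3 the triples already force distinctness; for n = 1 there is no
   condition at all. *)
Definition Cr_seq (n : nat) (a : 'I_n -> T) : Prop :=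
  (n = 2 -> forall i j : 'I_n, (i < j)%N -> a i <> a j) /\
  (forall i j l : 'I_n, (i < j)%N -> (j < l)%N -> Cr (a i) (a j) (a l)).

Definition lt_seq (n : nat) (a : 'I_n -> T) : Prop :=
  forall i j : 'I_n, (i < j)%N -> a i < a j.

Definition chain (k : kind) (n : nat) (a : 'I_n -> T) : Prop :=
  if circ k then Cr_seq a else lt_seq a.

(* [I_1 < ... < I_n] in the ordered kinds, [Crs(I_1, ..., I_n)] in the circular
   ones. *)
Definition interval_chain (k : kind) (n : nat) (I : 'I_n -> set T) : Prop :=
  (forall i, I i !=set0) /\
  (forall x : 'I_n -> T, (forall i, I i (x i)) -> chain k x).

Definition interval_transitive (k : kind) (n : nat) (G : set (T -> T)) : Prop :=
  forall I J : 'I_n -> set T,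
    (forall i, N_interval k (I i)) -> (forall i, N_interval k (J i)) ->
    interval_chain k I -> interval_chain k J ->
    exists2 g, G g & forall i, (g @` I i) `&` J i !=set0.

Definition approx_o_transitive (k : kind) (n : nat) (G : set (T -> T)) : Prop :=
  forall (a : 'I_n -> T) (I : 'I_n -> set T),
    chain k a -> (forall i, N_interval k (I i)) -> interval_chain k I ->
    exists2 g, G g & forall i, I i (g (a i)).

Definition highly_approx_o_transitive (k : kind) (G : set (T -> T)) : Prop :=
  forall n, (1 <= n)%N -> approx_o_transitive k n G.

Definition supp (f : T -> T) : set T := [set x | f x <> x].

Definition nearly_ordered (k : kind) (G : set (T -> T)) : Prop :=
  [/\ dense_order,
      if circ k then forall x y : T, endpoint x -> endpoint y -> x = y
      else forall x : T, ~ endpoint x,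
      forall g, G g -> automorphism k g &
      [/\ G id,
          forall f g, G f -> G g -> G (f \o g) &
          forall g, G g -> exists h, [/\ G h, cancel g h & cancel h g]]].

End OnAnOrder.

Arguments dense_order {d} T.

Section Completion.
Context {d : Order.disp_t}.

(* Dedekind cuts, represented by their closed lower halves.  Being bounded
   above and nonempty, they add no endpoint to [L].  The empty cut is allowed
   exactly in the circular kinds when [L] has no endpoint: it is then the least
   element of the completion, i.e. the adjoined endpoint. *)
Definition is_cut (k : kind) (L : orderType d) (A : set L) : Prop :=
  [/\ lbound (ubound A) = A,
      ubound A !=set0 &
      A !=set0 \/ (circ k /\ forall x : L, ~ endpoint x)].

Definition completion (k : kind) (L : orderType d) : Type :=
  {A : set L | `[< is_cut k A >]}.

Variables (k : kind) (L : orderType d).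
Local Notation Lbar := (completion k L).

HB.instance Definition _ := Choice.on Lbar.

Definition cut_le (A B : Lbar) : bool := `[< val A `<=` val B >].

Fact cut_le_refl : reflexive cut_le.
Proof. by move=> A; apply/asboolP. Qed.

Fact cut_le_anti : antisymmetric cut_le.
Proof.
move=> A B /andP[/asboolP AB /asboolP BA].
by apply: val_inj; rewrite eqEsubset.
Qed.

Fact cut_le_trans : transitive cut_le.
Proof.
move=> B A C /asboolP AB /asboolP BC; apply/asboolP.
exact: subset_trans BC.
Qed.

HB.instance Definition _ :=
  Order.Le_isPOrder.Build d Lbar cut_le_refl cut_le_anti cut_le_trans.

Fact cut_le_total : total (<=%O : rel Lbar).
Proof.
move=> [A pA] [B pB].
have [cA _ _] := asboolW pA; have [cB _ _] := asboolW pB.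
have [AB|/existsNP[a /not_implyP[Aa nBa]]] := pselect (A `<=` B).
  by apply/orP; left; apply/asboolP.
apply/orP; right; apply/asboolP => b /= Bb.
rewrite -cA => u uA.
apply: le_trans (uA _ Aa).
have [//|ab] := leP b a.
by case: nBa; rewrite -cB => v vB; exact: le_trans (ltW ab) (vB _ Bb).
Qed.

HB.instance Definition _ := Order.POrder_isTotal.Build d Lbar cut_le_total.

Fact principal_is_cut (x : L) : `[< is_cut k [set y | y <= x] >].
Proof.
apply/asboolP; split.
- apply/seteqP; split => y /=; first by apply => z.
  by move=> yx z /(_ x (lexx x)); exact: le_trans.
- by exists x => y.
- by left; exists x => /=.
Qed.

Definition embed (x : L) : Lbar :=
  exist (fun A : set L => `[< is_cut k A >]) _ (principal_is_cut x).

Definition dedekind_complete : Prop := forall A : Lbar, exists x, A = embed x.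

(* An automorphism of [N] has exactly one such extension [gbar]; supports and
   boundedness are those of [gbar]. *)
Definition extends (g : L -> L) (gbar : Lbar -> Lbar) : Prop :=
  automorphism k gbar /\ forall x, gbar (embed x) = embed (g x).

Definition bounded_perm (g : L -> L) : Prop :=
  exists2 gbar, extends g gbar &
  exists2 I, bounded_interval k I & supp gbar `<=` I.

End Completion.

(* Main.v *)
(** Let [g] be a nonidentity bounded element, so that [g] fixes a ray (or an
    arc) and satisfies [c < g c] for some [c].  Conjugating [g] by a group
    element that places [c] and [g c] suitably yields, for every point [z] and
    every proper nonempty initial segment [D] reaching past [z], an element
    that fixes everything up to [z] and does not preserve [D].  This is where
    3-interval-transitivity is used; in a Dedekind complete order, approximate
    2-o-transitivity suffices because [D] has a supremum.

    Hence, for [z < a], the orbit of [a] under the group [G_z] of elements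
    fixing everything up to [z] is cofinal (otherwise its downward closure
    would be an invariant [D]) and then dense above [z] (if it missed an
    interval [(p, q)] then, for [r] in that interval, the initial segment of
    points below all of the orbit beyond [r] would be invariant under [G_r]).
    One can therefore move [a_1, ..., a_n] into [I_1, ..., I_n] one at a time
    from the left, each move fixing the points already placed.

    In the circular kinds the same argument is run in the linear order obtained
    by cutting the circle at a point; the base point of the cut costs one extra
    degree of transitivity. *)

Require Import Defs.
From HB Require Import structures.
From mathcomp Require Import all_boot all_order.
From mathcomp Require Import boolp classical_sets.
Set Implicit Arguments.
Unset Strict Implicit.
Unset Printing Implicit Defensive.
Import Order.TTheory.
Local Open Scope classical_set_scope.
Local Open Scope order_scope.

Lemma neq_id_moved (T : Type) (g : T -> T) : g <> id -> exists x, g x <> x.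
Proof.
move=> gid; apply: contrapT => h; apply: gid; apply/funext => x.
by apply: contrapT => gx; apply: h; exists x.
Qed.

(** * Density of orbits in an abstract strict total order *)

Section StrictTotalOrder.
Context {T : eqType} (lt : rel T).

Definition strict_total : Prop :=
  [/\ irreflexive lt, transitive lt &
      forall x y, x <> y -> lt x y \/ lt y x].

Definition denserel : Prop := forall x y, lt x y -> exists z, lt x z /\ lt z y.

(** Cutting the circle may split a circular interval into two pieces, so target sets are only
    required to contain an order interval. *)
Definition thick (U : set T) : Prop :=
  exists p q, lt p q /\ forall y, lt p y -> lt y q -> U y.

Definition downset (D : set T) : Prop := forall x y, D y -> lt x y -> D x.

Hypothesis ltT : strict_total.

Lemma sto_irr x : lt x x = false.
Proof. by case: ltT => irr _ _; exact: irr. Qed.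

Lemma sto_trans y x z : lt x y -> lt y z -> lt x z.
Proof. by case: ltT => _ tr _; exact: tr. Qed.

Lemma sto_asym x y : lt x y -> ~~ lt y x.
Proof.
by move=> xy; apply/negP => /(sto_trans xy); rewrite sto_irr.
Qed.

Lemma sto_nlt x y : ~~ lt x y -> x = y \/ lt y x.
Proof.
case: ltT => _ _ tot nxy; have [->|xy] := eqVneq x y; first by left.
by case: (tot x y (elimN eqP xy)) => h; [rewrite h in nxy|right].
Qed.

Lemma sto_lt_le y x z : lt x y -> ~~ lt z y -> lt x z.
Proof. by move=> xy /sto_nlt[-> //|]; exact: sto_trans. Qed.

Lemma sto_le_lt y x z : ~~ lt y x -> lt y z -> lt x z.
Proof. by move=> /sto_nlt[-> //|xy] /(sto_trans xy). Qed.

Lemma downset_lt D x y : downset D -> D x -> ~ D y -> lt x y.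
Proof.
move=> dD Dx nDy; have [//|/sto_nlt[xy|yx]] := boolP (lt x y).
  by rewrite xy in Dx.
by case: nDy; exact: dD Dx yx.
Qed.

Lemma sets_lt_consecutive n (U : nat -> set T) :
  (forall i, (i < n)%N -> U i !=set0) ->
  (forall i x y, (i.+1 < n)%N -> U i x -> U i.+1 y -> lt x y) ->
  forall i j x y, (i < j)%N -> (j < n)%N -> U i x -> U j y -> lt x y.
Proof.
move=> U0 UU i j x + ij; elim: j ij => // j IH; rewrite ltnS leq_eqVlt.
case/predU1P => [->|ij] y jn Ux Uy; first exact: UU Ux Uy.
have [w Uw] := U0 j (ltnW jn).
exact: sto_trans (IH ij w (ltnW jn) Ux Uw) (UU _ _ _ jn Uw Uy).
Qed.

Hypothesis lt_dense : denserel.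
Variable G : set (T -> T).
Hypothesis GM : forall f g, G f -> G g -> G (f \o g).
Hypothesis GV : forall g, G g -> exists h, [/\ G h, cancel g h & cancel h g].
Hypothesis G1 : G id.

(** Monotonicity is imposed because [G] may contain reversing elements, and because its elements
    need not respect a cut of the circle. *)
Definition upper_mover (z : T) (g : T -> T) : Prop :=
  [/\ G g, {mono g : x y / lt x y} & forall y, ~~ lt z y -> g y = y].

Lemma upper_moverM z f g :
  upper_mover z f -> upper_mover z g -> upper_mover z (f \o g).
Proof.
move=> [Gf mf ff] [Gg mg fg]; split; first exact: GM.
- by move=> x y /=; rewrite mf mg.
- by move=> y zy /=; rewrite fg ?ff.
Qed.

Lemma upper_moverV z g : upper_mover z g ->
  exists h, [/\ upper_mover z h, cancel g h & cancel h g].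
Proof.
move=> [Gg mg fg]; have [h [Gh gh hg]] := GV Gg.
exists h; split=> //; split=> //.
- by move=> x y; rewrite -mg !hg.
- by move=> y zy; rewrite -{1}(fg _ zy) gh.
Qed.

Lemma upper_moverW z r g : ~~ lt r z -> upper_mover r g -> upper_mover z g.
Proof.
move=> zr [Gg mg fg]; split=> // y zy; apply: fg.
by apply: contra zy; exact: sto_le_lt.
Qed.

(** The interface between the two halves of the proof: the transitivity hypotheses serve only to
    establish this property, from which density of orbits follows. *)
Definition breaks_downsets : Prop := forall (z c y : T) (D : set T),
  downset D -> lt z c -> D c -> ~ D y ->
  exists2 k, upper_mover z k & exists2 w, D w & ~ D (k w).

Hypothesis breaks : breaks_downsets.

Lemma orbit_cofinal z a y : lt z a ->
  exists2 g, upper_mover z g & ~~ lt (g a) y.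
Proof.
move=> za.
pose D y := exists2 g, upper_mover z g & ~~ lt (g a) y.
have [//|nDy] := pselect (D y).
have dD : downset D.
  move=> u v [g gz gv] uv; exists g => //.
  by apply: contra gv => h; exact: sto_trans uv.
have Da : D a by exists id; [split|rewrite /= sto_irr].
have [k kz [w [g gz gw] []]] := breaks dD za Da nDy.
exists (k \o g); first exact: upper_moverM.
by case: kz => _ mk _; rewrite /= mk.
Qed.

Lemma orbit_dense z a (U : set T) : lt z a -> thick U ->
  (forall y, U y -> lt z y) -> exists2 g, upper_mover z g & U (g a).
Proof.
move=> za [p [q [pq pqU]]] zU.
(* If [p] were below [z], then [z] would itself lie between [p] and [q], hence in [U], and so above
   itself. *)
have zp : ~~ lt p z.
  apply/negP => pz; have [y [py yq]] := lt_dense pq.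
  have zy := zU _ (pqU _ py yq).
  by have := zU _ (pqU _ pz (sto_trans zy yq)); rewrite sto_irr.
(* Two points of the missed interval: [r] is the base of the new movers, and [s] witnesses that [D]
   reaches past [r]. *)
have [r [pr rq]] := lt_dense pq.
have [s [rs sq]] := lt_dense rq.
apply: contrapT => H.
have nU g : upper_mover z g -> ~ U (g a) by move=> gz Ug; apply: H; exists g.
have zr : ~~ lt r z by apply/sto_asym/(sto_le_lt zp pr).
pose D y := forall g, upper_mover z g -> ~~ lt (g a) r -> lt y (g a).
have dD : downset D.
  by move=> u v Dv uv g gz gr; exact: sto_trans uv (Dv g gz gr).
have Ds : D s.
  move=> g gz gr; have pg : lt p (g a) := sto_lt_le pr gr.
  have [//|sg] := boolP (lt s (g a)).
  case: (nU g gz); apply: pqU => //.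
  exact: sto_le_lt sg sq.
have [g0 g0z g0r] := orbit_cofinal r za.
have nDy : ~ D (g0 a) by move=> /(_ g0 g0z g0r); rewrite sto_irr.
have [k kr [w Dw []]] := breaks dD rs Ds nDy.
(* Pulling an orbit point not below [r] back by [k] gives another such point, since [k] fixes
   everything up to [r]; hence [k] maps [D] into itself. *)
move=> g gz gr; have [h [hr kh hk]] := upper_moverV kr.
have [_ mk kfix] := kr; have [_ mh hfix] := hr.
have kz := upper_moverW zr hr.
have : lt w (h (g a)).
  apply: (Dw _ (upper_moverM kz gz)).
  by rewrite /= -(hfix r) ?mh // sto_irr.
by rewrite -mk hk.
Qed.

(* Once [a_0] sits in [U_0], every later move fixes it, being supported above
   it. *)
Lemma orbit_dense_seq n z (a : nat -> T) (U : nat -> set T) :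
  (forall i, (i < n)%N -> lt z (a i)) ->
  (forall i j, (i < j)%N -> (j < n)%N -> lt (a i) (a j)) ->
  (forall i, (i < n)%N -> thick (U i)) ->
  (forall i y, (i < n)%N -> U i y -> lt z y) ->
  (forall i j x y, (i < j)%N -> (j < n)%N -> U i x -> U j y -> lt x y) ->
  exists2 g, upper_mover z g & forall i, (i < n)%N -> U i (g (a i)).
Proof.
elim: n => [|n IH] in z a U *.
  by move=> *; exists id.
move=> za aa tU zU UU.
have [g gz Ug] := orbit_dense (za 0 isT) (tU 0 isT) (fun y => zU 0 y isT).
have [_ mg _] := gz.
have [|||||h hz Uh] := IH (g (a 0)) (fun i => g (a i.+1)) (fun i => U i.+1).
- by move=> i ni; rewrite mg; apply: aa.
- by move=> i j ij jn; rewrite mg; apply: aa.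
- by move=> i ni; exact: tU.
- by move=> i y ni; apply: UU Ug.
- by move=> i j x y ij jn; apply: UU.
exists (h \o g).
  apply: upper_moverM gz; apply: upper_moverW hz; apply: sto_asym.
  exact: zU Ug.
move=> [_|i]; last exact: Uh.
by have [_ _ fh] := hz; rewrite /= fh ?sto_irr.
Qed.

End StrictTotalOrder.

Lemma lt_strict_total d (T : orderType d) : strict_total (<%O : rel T).
Proof.
split; [exact: ltxx|exact: lt_trans|move=> x y /eqP].
by rewrite neq_lt => /orP.
Qed.

(** * Embedding into the completion, and suprema *)

Section DedekindCompletion.
Context {d : Order.disp_t} (k : kind) (L : orderType d).

Lemma embed_le (x y : L) : (embed k x <= embed k y) = (x <= y).
Proof.
apply/asboolP/idP => [/(_ x (lexx x))//|xy z /= zx].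
exact: le_trans xy.
Qed.

Lemma embed_lt (x y : L) : (embed k x < embed k y) = (x < y).
Proof. by rewrite !ltNge embed_le. Qed.

Lemma embed_inj : injective (@embed d k L).
Proof.
by move=> x y xy; apply/le_anti; rewrite -!embed_le xy lexx.
Qed.

Lemma extends_fixed (g : L -> L) (gbar : completion k L -> completion k L) I x :
  extends g gbar -> supp gbar `<=` I -> ~ I (embed k x) -> g x = x.
Proof.
move=> [_ ext] sI nIx; apply: embed_inj; rewrite -ext.
by apply: contrapT => nx; apply: nIx; exact: sI.
Qed.

(** The cut generated by [D] is principal by completeness, and its generator is the supremum.
    Whether [e] itself lies in [D] is left open. *)
Lemma dedekind_complete_sup (D : set L) :
  dedekind_complete k L -> D !=set0 -> ubound D !=set0 ->
  downset <%O D ->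
  exists e, (forall w, w < e -> D w) /\ (forall w, e < w -> ~ D w).
Proof.
move=> hc [x Dx] [b Db] dD.
have DA : D `<=` lbound (ubound D) by move=> y Dy z; apply.
have cA : is_cut k (lbound (ubound D)).
  split.
  - apply/seteqP; split => [y Ay z Dz|y Ay z Az]; last exact: Az.
    by apply: Ay => w; apply.
  - by exists b => y; apply.
  - by left; exists x; exact: DA.
have [e /(congr1 val)/= Ae] :=
  hc (exist (fun A => `[< is_cut k A >]) _ (asboolT cA)).
exists e; split => w we.
- apply: contrapT => nDw.
  suff : ubound D w.
    have : lbound (ubound D) e by rewrite Ae /=.
    by move=> /(_ w) h /h; rewrite leNgt we.
  by move=> y Dy; rewrite leNgt; apply/negP => /(dD _ _ Dy).
- by move=> /DA; rewrite Ae /= leNgt we.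
Qed.

End DedekindCompletion.

(** * Breaking initial segments in the linear and monotonic kinds *)

Section LinearCase.
Context {d : Order.disp_t} {L : orderType d} (k : kind) (G : set (L -> L)).
Hypotheses (hk : circ k = false) (hG : nearly_ordered k G).

Let ltL := lt_strict_total L.

Lemma linear_no_max (x : L) : exists y, x < y.
Proof.
case: hG => _; rewrite hk => /(_ x) nx _ _; apply: contrapT => h.
by apply: nx; right => y; rewrite leNgt; apply/negP => xy; apply: h; exists y.
Qed.

Lemma linear_no_min (x : L) : exists y, y < x.
Proof.
case: hG => _; rewrite hk => /(_ x) nx _ _; apply: contrapT => h.
by apply: nx; left => y; rewrite leNgt; apply/negP => xy; apply: h; exists y.
Qed.

Lemma linear_dense : denserel (<%O : rel L).
Proof. by case: hG => dn _ _ _ x y /dn[z /andP[]]; exists z. Qed.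

(** A single pair kept in order excludes reversal. *)
Lemma linear_mono (f : L -> L) x y :
  automorphism k f -> x < y -> f x < f y -> {mono f : x y / x < y}.
Proof.
case: (k) hk => // _ [_]; first by [].
case=> // mf xy; rewrite mf => yx.
by have := lt_trans xy yx; rewrite ltxx.
Qed.

(** The lower end of the supporting interval is a cut [A], nonempty in these kinds; for any [u] in
    [A], the points up to [u] embed outside the interval. *)
Lemma linear_fixed (g : L -> L) :
  bounded_perm k g -> exists u, forall x, x <= u -> g x = x.
Proof.
move=> [gbar ext [I]]; rewrite /bounded_interval hk => -[A [B [AB ->]] sI].
have [cA _ [[u Au]|[ck _]]] := asboolW (valP A); last by move: ck; rewrite hk.
exists u => x xu; apply: extends_fixed ext sI _ => /=.
suff -> : A < embed k x = false by [].
apply/negbTE; rewrite -leNgt; apply/asboolP => y /= yx.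
rewrite -cA => z zA; exact: le_trans (le_trans yx xu) (zA _ Au).
Qed.

(** Two fixed points [v < u] exclude reversal. If [g] moves [c] down, its inverse moves [g c] up. *)
Lemma linear_pusher : (exists g, [/\ G g, g <> id & bounded_perm k g]) ->
  exists g u c, [/\ G g, {mono g : x y / x < y},
                   forall x, x <= u -> g x = x & c < g c].
Proof.
move=> [g [Gg /neq_id_moved[c /eqP gc] /linear_fixed[u gu]]].
have [_ _ aG [_ _ GV]] := hG.
have [v vu] := linear_no_min u.
have mg : {mono g : x y / x < y}.
  by apply: (linear_mono (aG _ Gg) vu); rewrite (gu v (ltW vu)) (gu u (lexx u)).
move: gc; rewrite neq_lt => /orP[gc|cg]; last by exists g, u, c.
have [h [Gh gh hg]] := GV _ Gg.
exists h, u, (g c); split => //; last by rewrite gh.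
- by move=> x y; rewrite -mg !hg.
- by move=> x xu; rewrite -{1}(gu x) // gh.
Qed.

(* The conjugate of [g] by [h] pushes the point [h i2] of [D] past
   [h i3], hence out of [D]. *)
Lemma linear_conj_breaks (g h : L -> L) (u c z i1 i2 i3 : L) (D : set L) :
  G g -> {mono g : x y / x < y} -> (forall x, x <= u -> g x = x) ->
  G h -> {mono h : x y / x < y} -> downset <%O D ->
  i1 < u -> c < i2 -> i3 < g c -> z < h i1 -> D (h i2) -> ~ D (h i3) ->
  exists2 f, upper_mover <%O G z f & exists2 w, D w & ~ D (f w).
Proof.
move=> Gg mg gu Gh mh dD i1u ci2 i3g zi1 D2 nD3.
have [_ _ _ [_ GM GV]] := hG.
have [h' [Gh' hh' h'h]] := GV _ Gh.
exists (h \o g \o h').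
  split; first by apply: (GM) => //; apply: (GM).
  - by move=> x y /=; rewrite mh mg -mh !h'h.
  - move=> y; rewrite -leNgt => yz /=; rewrite gu ?h'h //.
    by apply: ltW; apply: lt_trans i1u; rewrite -mh h'h; apply: le_lt_trans zi1.
exists (h i2) => //= Dw; apply: nD3; apply: dD Dw _.
by rewrite mh hh'; apply: lt_trans i3g _; rewrite mg.
Qed.

Hypothesis hb : exists g, [/\ G g, g <> id & bounded_perm k g].

Lemma linear_breaks_interval : interval_transitive k 3 G ->
  breaks_downsets <%O G.
Proof.
move=> h3 z c0 y D dD zc0 Dc0 nDy.
have [g [u [c [Gg mg gu cg]]]] := linear_pusher hb.
have [_ _ aG _] := hG.
have [e1 [ze1 e1c]] := linear_dense zc0.
have [p [cp pg]] := linear_dense cg.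
have c0y : c0 < y := downset_lt ltL dD Dc0 nDy.
have uc : u < c.
  by rewrite ltNge; apply/negP => /gu gc; rewrite gc ltxx in cg.
have chain3 (s : seq (set L)) :
    (forall i, (i < 3)%N -> nth set0 s i !=set0) ->
    (forall i x y, (i.+1 < 3)%N -> nth set0 s i x -> nth set0 s i.+1 y ->
       x < y) -> interval_chain k (fun i : 'I_3 => nth set0 s i).
  move=> s0 ss; split => [i|x sx]; first exact: s0.
  rewrite /chain hk => i j ij.
  exact: (sets_lt_consecutive ltL s0 ss ij).
(* A ray fixed by [g] and the two halves of the pushed interval go respectively above [z], into [D],
   and beyond [D]; [e1] keeps the first two targets apart. *)
pose I := [:: [set x | x < u]; [set x | c < x < p]; [set x | p < x < g c]].
pose J := [:: [set x | z < x < e1]; [set x | e1 < x < c0]; [set x | y < x]].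
have bI (a b : L) : a < b -> N_interval k [set x | a < x < b].
  by move=> ab; left; rewrite /bounded_interval hk; exists a, b.
have bI0 (a b : L) : a < b -> [set x | a < x < b] !=set0.
  by move=> /linear_dense[x [ax xb]]; exists x; rewrite /= ax.
have [||||h Gh hIJ] := h3 (fun i : 'I_3 => nth set0 I i)
                         (fun i : 'I_3 => nth set0 J i).
- move=> [[|[|[|//]]] ?]; rewrite /=; try exact: bI.
  by right; right; rewrite hk; exists u; right.
- move=> [[|[|[|//]]] ?]; rewrite /=; try exact: bI.
  by right; right; rewrite hk; exists y; left.
- apply: chain3 => [[|[|[|//]]] _|[|[|//]] x x' _] /=; try exact: bI0.
  + exact: linear_no_min.
  + by move=> xu /andP[cx' _]; exact: lt_trans xu (lt_trans uc cx').
  + by move=> /andP[_ xp] /andP[px' _]; exact: lt_trans px'.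
- apply: chain3 => [[|[|[|//]]] _|[|[|//]] x x' _] /=; try exact: bI0.
  + exact: linear_no_max.
  + by move=> /andP[_ xp] /andP[px' _]; exact: lt_trans px'.
  + by move=> /andP[_ xp] px'; exact: lt_trans (lt_trans xp c0y) px'.
have [_ [[i1 /= i1u <-] /andP[zi1 i1e]]] := hIJ (@Ordinal 3 0 isT).
have [_ [[i2 /= /andP[ci2 i2p] <-] /andP[ei2 i2c]]] := hIJ (@Ordinal 3 1 isT).
have [_ [[i3 /= /andP[pi3 i3g] <-] yi3]] := hIJ (@Ordinal 3 2 isT).
apply: (linear_conj_breaks Gg mg gu Gh _ dD i1u ci2 i3g zi1).
- apply: linear_mono (aG _ Gh) _ (lt_trans i1e ei2).
  exact: lt_trans i1u (lt_trans uc ci2).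
- exact: dD Dc0 i2c.
- by move=> /dD/(_ yi3).
Qed.

Lemma linear_breaks_complete :
  dedekind_complete k L -> approx_o_transitive k 2 G -> breaks_downsets <%O G.
Proof.
move=> hc h2 z c0 y D dD zc0 Dc0 nDy.
have [g [u [c [Gg mg gu cg]]]] := linear_pusher hb.
have [_ _ aG [_ _ GV]] := hG.
have [|||e [eD enD]] := dedekind_complete_sup (D := D) hc.
- by exists c0.
- by exists y => x Dx; exact/ltW/(downset_lt ltL dD).
- exact: dD.
have ze : z < e.
  by apply: lt_le_trans zc0 _; rewrite leNgt; apply/negP => /enD.
have uc : u < c.
  by rewrite ltNge; apply/negP => /gu gc; rewrite gc ltxx in cg.
(* Controlling the supremum [e] alone replaces controlling two points on either side of the boundary
   of [D]. *)
pose a := [:: z; e].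
pose I := [:: [set x | x < u]; [set x | c < x < g c]].
have [v vu] := linear_no_min u.
have [m [cm mg']] := linear_dense cg.
have [|||h Gh hI] := h2 (fun i : 'I_2 => nth z a i)
                        (fun i : 'I_2 => nth set0 I i).
- by rewrite /chain hk => -[[|[|//]] ?] [[|[|//]] ?].
- case=> [[|[|//]] ?] /=.
    by right; right; rewrite hk; exists u; right.
  by left; rewrite /bounded_interval hk; exists c, (g c).
- split=> [[[|[|//]] ?]|x Ix].
  + by exists v.
  + by exists m; rewrite /= cm.
  + rewrite /chain hk => -[[|[|//]] p0] [[|[|//]] p1] // _.
    have /andP[cx _] := Ix (Ordinal p1).
    exact: lt_trans (Ix (Ordinal p0)) (lt_trans uc cx).
have /= hz := hI (@Ordinal 2 0 isT).
have /= /andP[ch hg] := hI (@Ordinal 2 1 isT).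
have mh : {mono h : x y / x < y}.
  exact: linear_mono (aG _ Gh) ze (lt_trans hz (lt_trans uc ch)).
have [h' [Gh' hh' h'h]] := GV _ Gh.
have mh' : {mono h' : x y / x < y} by move=> x x'; rewrite -mh !h'h.
(* The conjugator is the inverse [h']: it sends [i2] and [i3] to either side of [e], and [i1] above
   [z]. *)
have [i1 [zi1 i1u]] := linear_dense hz.
have [i2 [ci2 i2h]] := linear_dense ch.
have [i3 [hi3 i3g]] := linear_dense hg.
apply: (linear_conj_breaks Gg mg gu Gh' mh' dD i1u ci2 i3g).
- by rewrite -mh h'h.
- by apply: eD; rewrite -mh h'h.
- by apply: enD; rewrite -mh h'h.
Qed.

End LinearCase.

(** * Selections with prescribed entries from a chain of intervals *)

Section ChainOfIntervals.
Context {d : Order.disp_t} {T : orderType d} (k : kind) (n : nat).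
Context (I : 'I_n -> set T).
Hypothesis cI : interval_chain k I.

(** The chain condition speaks of full selections only, so the prescribed points are completed by
    arbitrary choices from the other intervals. *)
Lemma interval_chain_pick3 i j l x y w : i != j -> i != l -> j != l ->
  I i x -> I j y -> I l w ->
  exists s, [/\ chain k s, s i = x, s j = y & s l = w].
Proof.
case: cI => /choice[b Ib] cs ij il jl Ix Iy Iw.
exists (fun u => if u == i then x else if u == j then y else
                 if u == l then w else b u).
split; last 3 first.
- by rewrite eqxx.
- by rewrite eq_sym (negbTE ij) eqxx.
- by rewrite eq_sym (negbTE il) eq_sym (negbTE jl) eqxx.
by apply: cs => u; case: eqP => [->|] //; case: eqP => [->|] //;
  case: eqP => [->|].
Qed.

Lemma interval_chain_pick2 i j x y : i != j -> I i x -> I j y ->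
  exists s, [/\ chain k s, s i = x & s j = y].
Proof.
case: cI => /choice[b Ib] cs ij Ix Iy.
exists (fun u => if u == i then x else if u == j then y else b u).
split; last 2 first.
- by rewrite eqxx.
- by rewrite eq_sym (negbTE ij) eqxx.
by apply: cs => u; case: eqP => [->|] //; case: eqP => [->|].
Qed.

End ChainOfIntervals.

Lemma neq_ltn_ord n (i j : 'I_n) : (i < j)%N -> i != j.
Proof. by move=> ij; rewrite -val_eqE neq_ltn ij. Qed.

(** * Approximate transitivity in the linear and monotonic kinds *)

Section LinearConclusion.
Context {d : Order.disp_t} {L : orderType d} (k : kind) (G : set (L -> L)).
Hypotheses (hk : circ k = false) (hG : nearly_ordered k G).

Lemma linear_interval_open (I : set L) b : N_interval k I -> I b ->
  exists p q, [/\ p < b, b < q & forall y, p < y -> y < q -> I y].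
Proof.
have [l lb] := linear_no_min hk hG b; have [r br] := linear_no_max hk hG b.
rewrite /N_interval /bounded_interval hk.
case=> [[x [y [xy ->]]] /= /andP[xb bry]|[->|[x [|] ->]] //= xb].
- by exists x, y; split=> // w xw wy; rewrite xw.
- by exists l, r.
- by exists x, r.
- by exists l, x.
Qed.

Lemma linear_highly : breaks_downsets <%O G -> highly_approx_o_transitive k G.
Proof.
have ltL := lt_strict_total L; have denseL := linear_dense hG.
have [_ _ _ [G1 GM GV]] := hG.
move=> br [//|n] _ a I; rewrite /chain hk => aa Iint cI.
have [b Ib] := choice cI.1.
have [z0 z0a] := linear_no_min hk hG (a ord0).
have [z1 z1b] := linear_no_min hk hG (b ord0).
(* Below [a ord0] for the movers, and below [b ord0] so that truncating the intervals at [z] leaves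
   them thick; the first one may be unbounded below. *)
pose z := Order.min z0 z1.
have za : z < a ord0 by rewrite gt_min z0a.
have zb : z < b ord0 by rewrite gt_min z1b orbT.
have IIlt (i j : 'I_n.+1) x y : (i < j)%N -> I i x -> I j y -> x < y.
  move=> ij Ix Iy.
  have [s []] := interval_chain_pick2 cI (neq_ltn_ord ij) Ix Iy.
  by rewrite /chain hk => cs <- <-; exact: cs.
have inlt i j : (i < j)%N -> (j < n.+1)%N ->
    ((inord i : 'I_n.+1) < (inord j : 'I_n.+1))%N.
  by move=> ij jn; rewrite !inordK // (ltn_trans ij).
have ge0 (f : 'I_n.+1 -> L) i : (i < n.+1)%N ->
    (forall i j : 'I_n.+1, (i < j)%N -> f i < f j) -> z < f ord0 ->
    z < f (inord i).
  move=> ni ff z0f; case: i => [|i] in ni *.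
    by rewrite (_ : inord 0 = ord0) //; apply: val_inj; rewrite /= inordK.
  by apply: lt_trans z0f _; apply: ff; rewrite inordK.
have [|||||g [Gg _ _] Ug] := orbit_dense_seq ltL denseL GM GV G1 br
    (n := n.+1) (z := z) (a := fun i => a (inord i))
    (U := fun i => I (inord i) `&` [set x | z < x]).
- by move=> i ni; apply: ge0.
- by move=> i j ij jn; apply/aa/inlt.
- move=> i ni; have zbi : z < b (inord i).
    by apply: (ge0 b) => // i' j' ij'; exact: IIlt ij' _ _.
  have [p [q [pb bq pqI]]] := linear_interval_open (Iint _) (Ib (inord i)).
  exists (Order.max p z), q; split.
    by rewrite gt_max (lt_trans pb bq) (lt_trans zbi bq).
  by move=> y; rewrite gt_max => /andP[py zy] yq; split=> //; exact: pqI.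
- by move=> i y _ [].
- by move=> i j x y ij jn [Ix _] [Iy _]; exact: IIlt (inlt _ _ ij jn) Ix Iy.
exists g => // i; have [] := Ug i (ltn_ord i).
by rewrite inord_val.
Qed.

End LinearConclusion.

(** * Cutting the circle at a point *)

Section Rotation.
Context {d : Order.disp_t} {T : orderType d}.
Implicit Types (o x y z : T) (f : T -> T).

Lemma Cr_rot x y z : Cr x y z = Cr y z x.
Proof. by rewrite /Cr [RHS]orbA orbC. Qed.

Lemma Cr_lt x y z : x < z -> Cr x y z = (x < y < z).
Proof.
move=> xz; apply/idP/idP; last by rewrite /Cr => ->.
case/or3P => // /andP[h h'].
  by have := lt_trans xz h'; rewrite ltxx.
by have := lt_trans xz h; rewrite ltxx.
Qed.

Lemma Cr_asym x y z : Cr x y z -> ~~ Cr z y x.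
Proof.
by rewrite /Cr; case: (ltgtP x y) => xy; case: (ltgtP y z) => yz;
  case: (ltgtP z x) => zx.
Qed.

(* The linear order obtained by cutting the circle at [o], which becomes the
   least element. *)
Definition lt_rot o : rel T :=
  fun y z => Cr o y z || ((y == o) && (z != o)).

(** The points from [o] upward come first, followed by those below [o]. *)
Lemma lt_rotE o y z :
  lt_rot o y z = if o <= y then (z < o) || (y < z) else y < z < o.
Proof.
rewrite /lt_rot /Cr; case: (ltgtP o y) => oy; case: (ltgtP y z) => yz;
  case: (ltgtP z o) => zo //=.
- by rewrite zo -oy ltxx in yz.
- by have := lt_trans zo yz; rewrite -oy ltxx.
- by rewrite oy yz ltxx in zo.
Qed.

Lemma lt_rot_total o : strict_total (lt_rot o).
Proof.
split=> [x|y x z|x y /eqP].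
- by rewrite lt_rotE ltxx; case: (ltP x o).
- rewrite !lt_rotE; case: (leP o x) => ox; case: (leP o y) => oy.
  + move=> /= xy; case/orP => [->//|yz].
    by rewrite (lt_trans xy yz) orbT.
  + by move=> _ /andP[_ ->].
  + by rewrite andbF.
  + by rewrite andbT => xy;  move=>  /andP[yz ->]; rewrite (lt_trans xy yz).
- rewrite !lt_rotE neq_lt => /orP[xy|yx].
    case: (leP o x) => ox; case: (leP o y) => oy; rewrite ?xy ?orbT ?ox; auto.
  case: (leP o x) => ox; case: (leP o y) => oy; rewrite ?yx ?orbT ?oy; auto.
Qed.

Lemma lt_rot_neq o x y : lt_rot o x y -> y != o.
Proof.
rewrite lt_rotE; apply: contraTneq => ->; rewrite ltxx /= andbF.
by case: leP => // ox; apply/negbTE; rewrite -leNgt.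
Qed.

Lemma Cr_lt_rot o x y : Cr o x y -> lt_rot o x y.
Proof. by rewrite /lt_rot => ->. Qed.

Lemma lt_rot_Cr o x y : x != o -> lt_rot o x y -> Cr o x y.
Proof. by rewrite /lt_rot => /negbTE ->; rewrite orbF. Qed.

Lemma Cr_of_rot o x y z : lt_rot o x y -> lt_rot o y z -> Cr x y z.
Proof.
rewrite !lt_rotE /Cr; case: (leP o x) => ox; case: (leP o y) => oy.
- move=> /= ->; case/orP => [zo|->//]; by rewrite (lt_le_trans zo ox) !orbT.
- move=> _ /andP[-> zo]; by rewrite (lt_le_trans zo ox) orbT.
- by rewrite andbF.
- by rewrite andbT => -> /andP[->].
Qed.

Lemma Cr_mid a x y z : Cr a x y -> Cr a y z -> Cr x y z.
Proof. by move=> /Cr_lt_rot axy /Cr_lt_rot; exact: Cr_of_rot axy. Qed.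

Lemma Cr_trans a x y z : Cr a x y -> Cr a y z -> Cr a x z.
Proof.
move=> axy ayz; apply: lt_rot_Cr.
  move: axy; rewrite /Cr; apply: contraTneq => ->; rewrite ltxx /= andbF orbF.
  by apply/negP => /andP[/lt_trans h /h]; rewrite ltxx.
exact: (sto_trans (lt_rot_total a)) (Cr_lt_rot axy) (Cr_lt_rot ayz).
Qed.

(** A circular interval whose ends are in increasing order for the cut does not wrap through [o]; a
    point outside the ends would give a triple of the opposite orientation. *)
Lemma Cr_between o p q x :
  lt_rot o p q -> Cr p x q = lt_rot o p x && lt_rot o x q.
Proof.
move=> pq; apply/idP/idP => [pxq|/andP[px]]; last exact: Cr_of_rot px.
have oT := lt_rot_total o.
have px : lt_rot o p x.
  have [//|/(sto_nlt oT)[e|xp]] := boolP (lt_rot o p x).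
    by move: pxq; rewrite e /Cr ltxx /=; case: ltgtP.
  by have := Cr_asym (Cr_of_rot xp pq); rewrite Cr_rot pxq.
rewrite px /=; have [//|/(sto_nlt oT)[e|qx]] := boolP (lt_rot o x q).
  by move: pxq; rewrite e /Cr ltxx /=; case: ltgtP.
by have := Cr_asym (Cr_of_rot pq qx); rewrite Cr_rot Cr_rot pxq.
Qed.

End Rotation.

(** * Cut orders and fixed arcs in the circular and monocircular kinds *)

Section CircularCase.
Context {d : Order.disp_t} {L : orderType d} (k : kind) (G : set (L -> L)).
Hypotheses (hk : circ k) (hG : nearly_ordered k G).
Hypothesis hb : exists g, [/\ G g, g <> id & bounded_perm k g].

Let circ_endpoint (x y : L) : endpoint x -> endpoint y -> x = y.
Proof. by case: hG => _; rewrite hk => h _ _; exact: h. Qed.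

Let lin_dense (x y : L) : x < y -> exists z, x < z /\ z < y.
Proof. by case: hG => dn _ _ _ /dn[z /andP[]]; exists z. Qed.

(** With at most one endpoint, a maximum and a minimum coincide, so [L] is a single point and has no
    nonidentity permutation. *)
Lemma no_max_and_min (x y : L) :
  (forall z, z <= x) -> (forall z, y <= z) -> False.
Proof.
move=> mx my; have xy : x = y by apply: circ_endpoint; [right|left].
have e z : z = x by apply: le_anti; rewrite mx xy my.
have [g [_ /neq_id_moved[z gz] _]] := hb.
by apply: gz; rewrite (e z); exact: e.
Qed.

Lemma lt_rot_no_max (o x : L) : exists y, lt_rot o x y.
Proof.
have [ox|xo] := leP o x; last first.
  by have [y [xy yo]] := lin_dense xo; exists y; rewrite lt_rotE leNgt xo xy.
apply: contrapT => h; apply: (@no_max_and_min x o) => z; rewrite leNgt;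
  by apply/negP => xz; apply: h; exists z; rewrite lt_rotE ox xz ?orbT.
Qed.

Lemma lt_rot_dense (o : L) : denserel (lt_rot o).
Proof.
move=> x y; rewrite lt_rotE; case: (leP o x) => [ox|xo].
  have [xy _|yx] := ltP x y.
    have [z [xz zy]] := lin_dense xy; exists z.
    by rewrite !lt_rotE ox (ltW (le_lt_trans ox xz)) xz zy !orbT.
  rewrite orbF => yo.
  (* The gap from [x] to [y] passes from the top of [L] to its bottom. It is empty only if [x] is
     greatest and [y] least. *)
  have [[w xw]|nx] := pselect (exists w, x < w).
    by exists w; rewrite !lt_rotE ox (ltW (le_lt_trans ox xw)) xw yo orbT.
  have [[w wy]|ny] := pselect (exists w, w < y).
    have wo := lt_trans wy yo.
    by exists w; rewrite !lt_rotE ox wo leNgt wo wy yo.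
  case: (@no_max_and_min x y) => z; rewrite leNgt; apply/negP => h.
    by apply: nx; exists z.
  by apply: ny; exists z.
move=> /andP[xy yo]; have [z [xz zy]] := lin_dense xy; exists z.
have zo := lt_trans zy yo.
by rewrite !lt_rotE !leNgt xo zo xz zy yo.
Qed.

Lemma circ_mono (f : L -> L) x y z : automorphism k f ->
  Cr x y z -> Cr (f x) (f y) (f z) ->
  forall u v w, Cr (f u) (f v) (f w) = Cr u v w.
Proof.
case: (k) hk => // _ [_]; first by [].
case=> // mf xyz fxyz; have := Cr_asym fxyz.
by rewrite mf xyz.
Qed.

Lemma lt_rot_mono (f : L -> L) o : bijective f ->
  (forall u v w, Cr (f u) (f v) (f w) = Cr u v w) -> f o = o ->
  {mono f : x y / lt_rot o x y}.
Proof.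
move=> /bij_inj fi mf fo x y; rewrite /lt_rot -{1 2 3}fo mf.
by rewrite !(inj_eq fi).
Qed.

(** The complementary arc, from [B] to [A], is fixed; the cases locate an order interval of [L]
    inside it. *)
Lemma circ_fixed (g : L -> L) : bounded_perm k g ->
  exists m l, m < l /\ forall x, m < x -> x < l -> g x = x.
Proof.
move=> [gbar ext [I]]; rewrite /bounded_interval hk => -[A [B [AB ->]] sI].
have nfix x : Cr B (embed k x) A -> g x = x.
  by move=> h; apply: extends_fixed ext sI _ => /=; apply/negP/Cr_asym.
have [cA _ nA] := asboolW (valP A); have [cB [b Bb] _] := asboolW (valP B).
have le_embed (C : completion k L) u : ubound (val C) u -> C <= embed k u.
  by move=> Cu; apply/asboolP => y /= /Cu.
have embed_le' (C : completion k L) u : val C u -> embed k u <= C.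
  move=> Cu; have [cC _ _] := asboolW (valP C); apply/asboolP => y /= yu.
  by rewrite -cC => w wC; exact: le_trans yu (wC _ Cu).
move/eqP: AB; rewrite neq_lt => /orP[AB|BA].
  have [[t bt]|nb] := pselect (exists t, b < t).
    exists b, t; split=> // x bx xt; apply: nfix; apply/or3P; apply: Or33.
    by rewrite AB (le_lt_trans (le_embed _ _ Bb)) // embed_lt.
  (* Nothing lies above [b], so [L] has an endpoint and the cut [A] is not the adjoined one. The
     interval is then found below a point of [A]. *)
  have mb z : z <= b by rewrite leNgt; apply/negP => bz; apply: nb; exists z.
  case: nA => [[a Aa]|[_ /(_ b)[]]]; last by right.
  have [[t ta]|na] := pselect (exists t, t < a).
    exists t, a; split=> // x tx xa; apply: nfix; apply/or3P; apply: Or32.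
    by rewrite AB andbT (lt_le_trans _ (embed_le' _ _ Aa)) // embed_lt.
  case: (@no_max_and_min b a) => // z.
  by rewrite leNgt; apply/negP => za; apply: na; exists z.
have /existsNP[l /not_implyP[Al nBl]] : ~ (val A `<=` val B).
  by move=> /asboolT h; move: BA; rewrite ltNge => /negP[].
have [m [Bm ml]] : exists m, ubound (val B) m /\ m < l.
  apply: contrapT => h; apply: nBl; rewrite -cB => m Bm.
  by rewrite leNgt; apply/negP => ml; apply: h; exists m.
exists m, l; split=> // x mx xl; apply: nfix; apply/or3P; apply: Or31.
rewrite (le_lt_trans (le_embed _ _ Bm)) ?embed_lt //=.
by rewrite (lt_le_trans _ (embed_le' _ _ Al)) // embed_lt.
Qed.

(** Cutting at a point [t] of the fixed arc makes [g] monotone for the cut; passing to the inverse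
    if necessary, [c] is pushed forward. *)
Lemma circ_pusher : exists g m l t c,
  [/\ G g, forall x y z, Cr (g x) (g y) (g z) = Cr x y z, m < t < l,
      forall x, m < x -> x < l -> g x = x & lt_rot t c (g c)].
Proof.
have [g [Gg /neq_id_moved[c gc] /circ_fixed[m [l [ml gfix]]]]] := hb.
have [_ _ aG [_ _ GV]] := hG.
have [t [mt tl]] := lin_dense ml.
have [r [mr rt]] := lin_dense mt; have [s [ts sl]] := lin_dense tl.
(* Three fixed points of the arc exclude reversal of orientation. *)
have mg x y z : Cr (g x) (g y) (g z) = Cr x y z.
  have rts : Cr r t s by rewrite /Cr rt ts.
  apply: (circ_mono (aG _ Gg) rts).
  by rewrite !gfix // ?(lt_trans mt) ?(lt_trans rt).
case: (lt_rot_total t) => _ _ /(_ _ _ gc)[gcc|cgc]; last first.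
  by exists g, m, l, t, c; split=> //; rewrite mt.
have [h [Gh gh hg]] := GV _ Gg.
exists h, m, l, t, (g c); split=> //.
- by move=> x y z; rewrite -mg !hg.
- by rewrite mt.
- by move=> x mx xl; rewrite -{1}(gfix x) // gh.
- by rewrite gh.
Qed.

(** * Conjugates of a bounded element on the circle *)

Section Conjugation.
Variables (g : L -> L) (m l t c : L).
Hypotheses (Gg : G g) (mg : forall x y z, Cr (g x) (g y) (g z) = Cr x y z).
Hypotheses (mtl : m < t < l) (gfix : forall x, m < x -> x < l -> g x = x).
Hypothesis cgc : lt_rot t c (g c).

Let mt : m < t. Proof. by case/andP: mtl. Qed.
Let tl : t < l. Proof. by case/andP: mtl. Qed.
Let tT := lt_rot_total t.

(** Otherwise [c] would lie in the fixed arc, between [t] and [x]. *)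
Lemma before_push x : t < x -> x < l -> lt_rot t x c.
Proof.
move=> tx xl; have [//|/(sto_nlt tT) h] := boolP (lt_rot t x c).
suff gc : g c = c by move: cgc; rewrite gc (sto_irr tT).
case: h => [<-|]; first by apply: gfix => //; exact: lt_trans tx.
rewrite lt_rotE; case: (leP t c) => tc.
  rewrite ltNge (ltW tx) /= => cx; apply: gfix; first exact: lt_le_trans tc.
  exact: lt_trans xl.
by move=> /andP[_ /(lt_trans tx)]; rewrite ltxx.
Qed.

(** Otherwise [g c] would lie in the fixed arc, and [c] would be fixed by injectivity of [g]. *)
Lemma after_push x : m < x -> x < t -> lt_rot t (g c) x.
Proof.
move=> mx xt; have [//|/(sto_nlt tT) h] := boolP (lt_rot t (g c) x).
have [h' [_ gh' _]] : exists h', [/\ G h', cancel g h' & cancel h' g].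
  by case: hG => _ _ _ [_ _]; apply.
suff ggc : g (g c) = g c.
  by move: cgc; rewrite (can_inj gh' ggc) (sto_irr tT).
case: h => [->|]; first by apply: gfix => //; exact: lt_trans tl.
rewrite lt_rotE leNgt xt /= => /andP[xc ct]; apply: gfix.
  exact: lt_trans xc.
exact: lt_trans tl.
Qed.

(* The conjugate of [g] by [h] fixes the arc from [h i4] to [h i1], which
   contains everything up to [z], and pushes the point [h i2] of [D] past
   [h i3], hence out of [D]. *)
Lemma circ_conj_breaks (h : L -> L) (z o i1 i2 i3 i4 : L) (D : set L) :
  G h -> (forall x y w, Cr (h x) (h y) (h w) = Cr x y w) ->
  downset (lt_rot o) D ->
  t < i1 -> i1 < l -> lt_rot t c i2 -> lt_rot t i2 i3 -> lt_rot t i3 (g c) ->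
  m < i4 -> i4 < t -> Cr (h i4) o (h i1) -> lt_rot o z (h i1) ->
  D (h i2) -> ~ D (h i3) ->
  exists2 f, upper_mover (lt_rot o) G z f & exists2 w, D w & ~ D (f w).
Proof.
move=> Gh mh dD ti1 i1l ci2 i23 i3g mi4 i4t h4o1 z1 D2 nD3.
have [_ _ aG [_ GM GV]] := hG; have oT := lt_rot_total o.
have [h' [Gh' hh' h'h]] := GV _ Gh.
have bG f : G f -> bijective f by move=> /aG[].
pose f := h \o g \o h'.
have Gf : G f by apply: (GM) => //; apply: (GM).
have mf x y w : Cr (f x) (f y) (f w) = Cr x y w.
  by rewrite /f /= mh mg -mh !h'h.
have ffix y : ~~ lt_rot o z y -> f y = y.
  move=> zy; have y1 : lt_rot o y (h i1) := sto_le_lt oT zy z1.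
  have h4y1 : Cr (h i4) y (h i1).
    have [->//|yo] := eqVneq y o; have oy1 := lt_rot_Cr yo y1.
    rewrite -Cr_rot; apply: (@Cr_trans _ _ _ _ o); first by rewrite Cr_rot.
    by rewrite Cr_rot.
  rewrite /f /= gfix ?h'h //.
    move: h4y1; rewrite -{1}[y]h'h mh (Cr_lt _ (lt_trans i4t ti1)).
    move=> /andP[i4y _].
    exact: lt_trans mi4 i4y.
  move: h4y1; rewrite -{1}[y]h'h mh (Cr_lt _ (lt_trans i4t ti1)).
  move=> /andP[_ yi1].
  exact: lt_trans yi1 i1l.
have fo : f o = o.
  apply: ffix; apply/negP => /lt_rot_neq; by rewrite eqxx.
exists f; first by split=> //; exact: lt_rot_mono (bG _ Gf) mf fo.
exists (h i2) => // Dw; apply: nD3; apply: (dD _ _ Dw).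
rewrite /f /= hh'.
have gt : g t = t by exact: gfix.
have mgt := lt_rot_mono (bG _ Gg) mg gt.
have g4 : g i4 = i4 by apply: gfix => //; exact: lt_trans tl.
have gc4 := after_push mi4 i4t.
have i34 : lt_rot t i3 i4 := sto_trans tT i3g gc4.
have i3g2 : lt_rot t i3 (g i2) by apply: (sto_trans tT i3g); rewrite mgt.
have g24 : lt_rot t (g i2) i4.
  by rewrite -g4 mgt; exact: (sto_trans tT i23 i34).
have i13 : lt_rot t i1 i3.
  exact: (sto_trans tT (sto_trans tT (before_push ti1 i1l) ci2) i23).
(* Read from [h i4], the circle meets [o], [h i1], [h i3] and [h (g i2)] in this order. *)
have h413 : Cr (h i4) (h i1) (h i3).
  by rewrite mh Cr_rot; exact: Cr_of_rot i13 i34.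
have h432 : Cr (h i4) (h i3) (h (g i2)).
  by rewrite mh Cr_rot; exact: Cr_of_rot i3g2 g24.
exact/Cr_lt_rot/(Cr_mid (Cr_trans h4o1 h413) h432).
Qed.

End Conjugation.

(** * Breaking initial segments of a cut circle *)

Lemma Cr_interval (x y : L) : x != y -> N_interval k [set z | Cr x z y].
Proof.
by move=> /eqP xy; left; rewrite /bounded_interval hk; exists x, y.
Qed.

Lemma lt_rot_lt_neq (o x y : L) : lt_rot o x y -> x != y.
Proof. by apply: contraTneq => ->; rewrite (sto_irr (lt_rot_total o)). Qed.

Lemma interval_chain_lt_rot n (o : L) (U : nat -> set L) : (2 < n)%N ->
  (forall i, (i < n)%N -> U i !=set0) ->
  (forall i x y, (i.+1 < n)%N -> U i x -> U i.+1 y -> lt_rot o x y) ->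
  interval_chain k (fun i : 'I_n => U i).
Proof.
move=> n2 U0 UU; split=> [i|x Ux]; first exact: U0.
have xx (i j : 'I_n) : (i < j)%N -> lt_rot o (x i) (x j).
  move=> ij; exact: (sets_lt_consecutive (lt_rot_total o) U0 UU ij).
rewrite /chain hk; split=> [n2'|i j w ij jw]; first by rewrite n2' in n2.
exact: Cr_of_rot (xx _ _ ij) (xx _ _ jw).
Qed.

Lemma circ_breaks_interval (o : L) : interval_transitive k 4 G ->
  breaks_downsets (lt_rot o) G.
Proof.
move=> h4 z c0 y D dD zc0 Dc0 nDy.
have [g [m [l [t [c [Gg mg mtl gfix cgc]]]]]] := circ_pusher.
have [mt tl] := andP mtl; have [_ _ aG _] := hG.
have oT := lt_rot_total o; have tT := lt_rot_total t.
have [e1 [ze1 e1c]] := lt_rot_dense zc0.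
have [p [cp pg]] := lt_rot_dense cgc.
have [e4 ye4] := lt_rot_no_max o y.
have c0y : lt_rot o c0 y := downset_lt oT dD Dc0 nDy.
have bt := before_push mtl gfix cgc; have af := after_push Gg mtl gfix cgc.
have J4 x : Cr e4 x o = lt_rot o e4 x.
  by rewrite -Cr_rot /lt_rot (negbTE (lt_rot_neq ye4)) orbF.
(* The outer intervals of [I] lie in the fixed arc on either side of [t]; the middle ones halve the
   pushed arc. The fourth target ends at [o], which places [o] between [h i4] and [h i1]. *)
pose I := [:: [set x | Cr t x l]; [set x | Cr c x p]; [set x | Cr p x (g c)];
             [set x | Cr m x t]].
pose J := [:: [set x | Cr z x e1]; [set x | Cr e1 x c0]; [set x | Cr y x e4];
             [set x | Cr e4 x o]].
have Ilin (a b x : L) : a < b -> a < x -> x < b -> Cr a x b.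
  by move=> ab ax xb; rewrite Cr_lt ?ax.
have Irot (b p' q x : L) :
    lt_rot b p' q -> Cr p' x q -> lt_rot b p' x /\ lt_rot b x q.
  by move=> pq; rewrite (Cr_between _ pq) => /andP[].
have I0 (b p' q : L) : lt_rot b p' q -> [set x | Cr p' x q] !=set0.
  move=> pq; have [x [px xq]] := lt_rot_dense pq.
  by exists x; exact: Cr_of_rot px xq.
have [||||h Gh hIJ] := h4 (fun i : 'I_4 => nth set0 I i)
                         (fun i : 'I_4 => nth set0 J i).
- move=> [[|[|[|[|//]]]] ?] /=; apply: Cr_interval.
  + by rewrite lt_eqF.
  + exact: lt_rot_lt_neq cp.
  + exact: lt_rot_lt_neq pg.
  + by rewrite lt_eqF.
- move=> [[|[|[|[|//]]]] ?] /=; apply: Cr_interval.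
  + exact: lt_rot_lt_neq ze1.
  + exact: lt_rot_lt_neq e1c.
  + exact: lt_rot_lt_neq ye4.
  + exact: lt_rot_neq ye4.
- apply: (interval_chain_lt_rot (o := t)) => //
    [[|[|[|[|//]]]] _|[|[|[|//]]] x x' _] /=; try exact: I0.
  + have [r [tr rl]] := lin_dense tl; exists r; exact: Ilin.
  + exact: I0 cp.
  + exact: I0 pg.
  + have [r [mr rt]] := lin_dense mt; exists r; exact: Ilin.
  + rewrite Cr_lt // => /andP[tx xl] /(Irot _ _ _ _ cp)[cx' _].
    exact: (sto_trans tT (bt _ tx xl)).
  + move=> /(Irot _ _ _ _ cp)[_ xp] /(Irot _ _ _ _ pg)[px' _].
    exact: (sto_trans tT xp).
  + move=> /(Irot _ _ _ _ pg)[_ xg]; rewrite Cr_lt // => /andP[mx' x't].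
    exact: (sto_trans tT xg (af _ mx' x't)).
- apply: (interval_chain_lt_rot (o := o)) => //
    [[|[|[|[|//]]]] _|[|[|[|//]]] x x' _] /=.
  + exact: I0 ze1.
  + exact: I0 e1c.
  + exact: I0 ye4.
  + by have [r e4r] := lt_rot_no_max o e4; exists r; rewrite /= J4.
  + move=> /(Irot _ _ _ _ ze1)[_ xp] /(Irot _ _ _ _ e1c)[px' _].
    exact: (sto_trans oT xp).
  + move=> /(Irot _ _ _ _ e1c)[_ xp] /(Irot _ _ _ _ ye4)[px' _].
    exact: (sto_trans oT xp (sto_trans oT c0y px')).
  + move=> /(Irot _ _ _ _ ye4)[_ xp]; rewrite J4.
    exact: (sto_trans oT xp).
have [_ [[i1 Ii1 <-] Ji1]] := hIJ (@Ordinal 4 0 isT).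
have [_ [[i2 Ii2 <-] Ji2]] := hIJ (@Ordinal 4 1 isT).
have [_ [[i3 Ii3 <-] Ji3]] := hIJ (@Ordinal 4 2 isT).
have [_ [[i4 Ii4 <-] Ji4]] := hIJ (@Ordinal 4 3 isT).
move: Ii1 Ii4; rewrite /= !Cr_lt // => /andP[ti1 i1l] /andP[mi4 i4t].
have [ci2 i2p] := Irot _ _ _ _ cp Ii2; have [pi3 i3g] := Irot _ _ _ _ pg Ii3.
have [zi1 i1e] := Irot _ _ _ _ ze1 Ji1; have [ei2 i2c] := Irot _ _ _ _ e1c Ji2.
have [yi3 i3e] := Irot _ _ _ _ ye4 Ji3.
have {Ji4}e4i4 : lt_rot o e4 (h i4) by rewrite -J4.
have i12 := sto_trans oT i1e ei2.
have i23 := sto_trans oT i2c (sto_trans oT c0y yi3).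
have i34 := sto_trans oT i3e e4i4.
have mh x x' w : Cr (h x) (h x') (h w) = Cr x x' w.
  apply: (circ_mono (aG _ Gh) (x := i1) (y := i2) (z := i3)).
    apply: Cr_of_rot (sto_trans tT i2p pi3).
    exact: (sto_trans tT (bt _ ti1 i1l)).
  exact: Cr_of_rot i12 i23.
apply: (circ_conj_breaks Gg mg mtl gfix cgc Gh mh dD ti1 i1l ci2
          (sto_trans tT i2p pi3) i3g mi4 i4t _ zi1).
- rewrite Cr_rot; apply: lt_rot_Cr; first exact: lt_rot_neq zi1.
  exact: (sto_trans oT i12 (sto_trans oT i23 i34)).
- exact: dD Dc0 i2c.
- by move=> /dD/(_ yi3).
Qed.

(** [D] may run past the wrap to points below [o], be bounded in [L] before it, or stop exactly at
    the wrap. *)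
Lemma complete_sup_rot o (D : set L) c y : dedekind_complete k L ->
  downset (lt_rot o) D -> D c -> ~ D y ->
  exists e, (forall w, lt_rot o w e -> D w) /\
            (forall w, lt_rot o e w -> ~ D w).
Proof.
move=> hc dD Dc nDy; have oT := lt_rot_total o.
have rE := lt_rotE o.
have lo x : x != o -> lt_rot o o x by move=> xo; rewrite /lt_rot eqxx xo orbT.
have Do : D o.
  by have [<-//|co] := eqVneq c o; apply: dD Dc (lo _ co).
have wrap x w : o <= x -> w < o -> lt_rot o x w by rewrite rE => -> ->.
have ge x w : o <= x -> o <= w -> lt_rot o x w = (x < w).
  by move=> ox ow; rewrite rE ox ltNge ow.
have lt x w : x < o -> w < o -> lt_rot o x w = (x < w).
  by move=> xo wo; rewrite rE leNgt xo wo andbT.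
(* Past the wrap, [D] contains everything from [o] upward, and only its part below [o] needs a
   supremum. *)
have [[y0 [Dy0 y0o]]|nD] := pselect (exists y0, D y0 /\ y0 < o).
  have yo : y < o.
    rewrite ltNge; apply/negP => oy; apply: nDy.
    exact: dD Dy0 (wrap _ _ oy y0o).
  have nD1 w : y < w -> ~ (w < o /\ D w).
    by move=> yw [wo /dD h]; apply/nDy/h; rewrite lt.
  have [|||e [eD enD]] := dedekind_complete_sup
      (D := [set w | w < o /\ D w]) hc.
  - by exists y0.
  - by exists y => w [wo Dw]; rewrite leNgt; apply/negP => /nD1; apply.
  - move=> u w [wo Dw] uw; have uo := lt_trans uw wo.
    by split=> //; apply: (dD _ _ Dw); rewrite lt.
  have ey : e <= y by rewrite leNgt; apply/negP => /eD[_ /nDy].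
  have eo := le_lt_trans ey yo.
  exists e; split=> w.
    have [ow _|wo] := leP o w; first exact: dD Dy0 (wrap _ _ ow y0o).
    by rewrite lt // => /eD[].
  rewrite rE leNgt eo /= => /andP[ew wo] Dw; exact: (enD w).
have Dge w : D w -> o <= w.
  by move=> Dw; rewrite leNgt; apply/negP => wo; apply: nD; exists w.
(* Adding the points below [o] gives an initial segment of [L] with the same upper bounds. *)
pose D2 := [set w | w < o \/ D w].
have dD2 : downset <%O D2.
  move=> u w [wo|Dw] uw; first by left; exact: lt_trans wo.
  have [ou|] := leP o u; [right|by left].
  by apply: (dD _ _ Dw); rewrite ge // (Dge _ Dw).
have [ubD2|nub] := pselect (ubound D2 !=set0).
  have [|e [eD enD]] := dedekind_complete_sup hc _ ubD2 dD2.
    by exists o; right.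
  have oe : o <= e by rewrite leNgt; apply/negP => /enD[]; right.
  exists e; split=> w.
    have [ow|wo] := leP o w; last first.
      rewrite rE leNgt wo /= => /andP[we eo].
      by move: (lt_le_trans eo oe); rewrite ltxx.
    by rewrite ge // => /eD[]//; rewrite ltNge ow.
  by move=> + Dw; rewrite ge // ?Dge // => /enD; apply; right.
have DT w : o <= w -> D w.
  move=> ow; apply: contrapT => nDw; apply: nub; exists w => x [xo|Dx].
    exact: le_trans (ltW xo) ow.
  rewrite leNgt; apply/negP => wx; apply: nDw; apply: (dD _ _ Dx).
  by rewrite ge // (le_trans ow) // ltW.
(* Here [D] is the whole unbounded ray from [o] upward, so its supremum in the cut is the least
   element of [L]. Without an endpoint, the empty cut would be a point of the completion missing
   from [L]. *)
have [e ee] : exists e : L, endpoint e.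
  apply: contrapT => h.
  have c0 : is_cut k (set0 : set L).
    split.
    - rewrite -subset0 => x xl; apply: h; exists x; left => w; exact: xl.
    - by exists o.
    - by right; split=> // x xe; apply: h; exists x.
  have [x /(congr1 val)/= x0] :=
    hc (exist (fun A => `[< is_cut k A >]) _ (asboolT c0)).
  by have : [set y | y <= x] x := lexx x; rewrite -x0.
case: ee => [emin|emax]; last by case: nub; exists e => w _; exact: emax.
have eo : e < o.
  rewrite ltNge; apply/negP => oe; apply/nDy/DT.
  exact: le_trans (emin y).
exists e; split=> w.
  have [ow _|wo] := leP o w; first exact: DT.
  by rewrite lt // ltNge emin.
by rewrite rE leNgt eo /= => /andP[_ wo] /Dge; rewrite leNgt wo.
Qed.

Lemma circ_breaks_complete (o : L) : dedekind_complete k L ->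
  approx_o_transitive k 3 G -> breaks_downsets (lt_rot o) G.
Proof.
move=> hc h3 z c0 y D dD zc0 Dc0 nDy.
have [g [m [l [t [c [Gg mg mtl gfix cgc]]]]]] := circ_pusher.
have [mt tl] := andP mtl; have [_ _ aG [_ _ GV]] := hG.
have oT := lt_rot_total o; have tT := lt_rot_total t.
have bt := before_push mtl gfix cgc; have af := after_push Gg mtl gfix cgc.
have [e [eD enD]] := complete_sup_rot hc dD Dc0 nDy.
have ze : lt_rot o z e.
  by apply: (sto_lt_le oT zc0); apply/negP => /enD.
(* Since [z] may equal [o], a later point [z'] is used to form a proper circular triple with [o] and
   [e]. *)
have [z' [zz' z'e]] := lt_rot_dense ze.
have oz'e : Cr o z' e := lt_rot_Cr (lt_rot_neq zz') z'e.
pose a := [:: o; z'; e].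
pose I := [:: [set x | Cr m x t]; [set x | Cr t x l]; [set x | Cr c x (g c)]].
have chain3 (x : 'I_3 -> L) :
    Cr (x (@Ordinal 3 0 isT)) (x (@Ordinal 3 1 isT)) (x (@Ordinal 3 2 isT)) ->
    chain k x.
  move=> Cx; rewrite /chain hk; split=> // -[[|[|[|//]]] p0] [[|[|[|//]]] p1]
    [[|[|[|//]]] p2] // _ _.
  by rewrite (bool_irrelevance p0 isT) (bool_irrelevance p1 isT)
             (bool_irrelevance p2 isT).
have Irot x : Cr c x (g c) -> lt_rot t c x /\ lt_rot t x (g c).
  by rewrite (Cr_between _ cgc) => /andP[].
have [|||h Gh hI] := h3 (fun i : 'I_3 => nth z a i)
                        (fun i : 'I_3 => nth set0 I i).
- exact: chain3.
- move=> [[|[|[|//]]] ?] /=; apply: Cr_interval.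
  + by rewrite lt_eqF.
  + by rewrite lt_eqF.
  + exact: lt_rot_lt_neq cgc.
- split=> [[[|[|[|//]]] ?]|x Ix] /=.
  + by have [r [mr rt]] := lin_dense mt; exists r; rewrite /= Cr_lt ?mr.
  + by have [r [mr rt]] := lin_dense tl; exists r; rewrite /= Cr_lt ?mr.
  + by have [r [cr rg]] := lt_rot_dense cgc; exists r; exact: Cr_of_rot cr rg.
  + apply: chain3.
    move: (Ix (@Ordinal 3 0 isT)) (Ix (@Ordinal 3 1 isT))
      (Ix (@Ordinal 3 2 isT)).
    rewrite /= (Cr_lt _ mt) (Cr_lt _ tl) => /andP[mx0 x0t].
    move=> /andP[tx1 x1l] /Irot[cx2 x2g].
    rewrite Cr_rot; apply: Cr_of_rot (sto_trans tT x2g (af _ mx0 x0t)).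
    exact: (sto_trans tT (bt _ tx1 x1l)).
have /= := hI (@Ordinal 3 0 isT); rewrite Cr_lt // => /andP[mho hot].
have /= := hI (@Ordinal 3 1 isT); rewrite Cr_lt // => /andP[thz hzl].
have /= /Irot[che heg] := hI (@Ordinal 3 2 isT).
have hze : lt_rot t (h z') (h e) := sto_trans tT (bt _ thz hzl) che.
have gho := af _ mho hot.
have mh x x' w : Cr (h x) (h x') (h w) = Cr x x' w.
  apply: (circ_mono (aG _ Gh) oz'e); rewrite Cr_rot.
  exact: Cr_of_rot hze (sto_trans tT heg gho).
have [h' [Gh' hh' h'h]] := GV _ Gh.
have mh' x x' w : Cr (h' x) (h' x') (h' w) = Cr x x' w.
  by rewrite -mh !h'h.
(* The conjugator is [h'], with [h z'] in the role of [i1]; [i4] before [h o] puts [o] in the fixed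
   arc, and [i2], [i3] straddle [h e]. *)
have [i4 [mi4 i4o]] := lin_dense mho.
have [i2 [ci2 i2e]] := lt_rot_dense che.
have [i3 [ei3 i3g]] := lt_rot_dense heg.
apply: (circ_conj_breaks Gg mg mtl gfix cgc Gh' mh' dD thz hzl ci2
          (sto_trans tT i2e ei3) i3g mi4 (lt_trans i4o hot)).
- rewrite -mh !h'h; apply/or3P/Or31.
  by rewrite i4o (lt_trans hot).
- by rewrite hh'.
- apply: eD; have : Cr z' (h' i2) e.
    rewrite -mh h'h; apply: Cr_of_rot i2e.
    exact: (sto_trans tT (bt _ thz hzl)).
  by rewrite (Cr_between _ z'e) => /andP[].
- apply: enD; apply: Cr_lt_rot; rewrite Cr_rot -mh h'h.
  exact: Cr_of_rot ei3 (sto_trans tT i3g gho).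
Qed.

(** * Approximate transitivity in the circular and monocircular kinds *)

Lemma circ_interval_thick o (I : set L) : N_interval k I -> thick (lt_rot o) I.
Proof.
have oT := lt_rot_total o.
have lo x : x != o -> lt_rot o o x by move=> xo; rewrite /lt_rot eqxx xo orbT.
have [r or] := lt_rot_no_max o o.
rewrite /N_interval /bounded_interval hk.
case=> [[x [y [/eqP xy ->]]]|[->|[x ->]]]; last 2 first.
- by exists o, r.
- have [->|xo] := eqVneq x o.
    by exists o, r; split=> // y /lt_rot_neq/eqP.
  exists o, x; split; first exact: lo.
  by move=> y _ /lt_rot_lt_neq/eqP.
have [xo|xo] := eqVneq x o.
  rewrite xo in xy *; exists o, y; split; first by apply: lo; rewrite eq_sym.
  by move=> w /lt_rot_neq wo; exact: lt_rot_Cr.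
have [yo|yo] := eqVneq y o.
  have [q xq] := lt_rot_no_max o x; exists x, q; split=> // w xw _.
  by rewrite /= yo -Cr_rot; exact: lt_rot_Cr.
have /eqP xy' := xy; case: oT => _ _ /(_ _ _ xy')[lxy|lyx].
  by exists x, y; split=> // w xw wy; exact: Cr_of_rot xw wy.
(* The interval wraps through [o]; only its piece after [o] is kept. *)
exists o, y; split=> [|w _ wy]; first exact: lo.
by rewrite /= Cr_rot; exact: Cr_of_rot wy lyx.
Qed.

(** For [i] positive this is a triple starting at [0]. For [i] zero, distinctness comes from a
    triple with a third index, or from the separate clause when the length is 2. *)
Lemma Cr_seq_lt_rot n (a : 'I_n.+1 -> L) (i j : 'I_n.+1) :
  Cr_seq a -> (i < j)%N -> lt_rot (a ord0) (a i) (a j).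
Proof.
move=> [a2 a3] ij; have [i0|i0] := posnP i; last first.
  exact/Cr_lt_rot/a3.
have -> : i = ord0 by exact: val_inj.
have j0 : (0 < j)%N by rewrite -i0.
suff ja : a j != a ord0 by rewrite /lt_rot eqxx ja orbT.
have [jn|nj] := ltnP j n.
  have := a3 ord0 j ord_max j0 jn.
  by apply: contraTneq => ->; rewrite /Cr ltxx /=; case: ltgtP.
have jn : nat_of_ord j = n by apply/eqP; rewrite eqn_leq nj -ltnS ltn_ord.
have [n1|n1] := leqP n 1.
  apply/eqP => e; apply: (a2 _ ord0 j j0) => //.
  by congr S; apply/eqP; rewrite eqn_leq n1 -jn.
have := a3 ord0 (inord 1) j.
rewrite inordK ?ltnS ?(ltnW n1) // jn => /(_ isT n1).
apply: contraTneq => ->; apply/negP => h.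
by have := Cr_asym h; rewrite h.
Qed.

Lemma circ_highly : (forall o, breaks_downsets (lt_rot o) G) ->
  highly_approx_o_transitive k G.
Proof.
have [_ _ aG [G1 GM GV]] := hG.
move=> br [//|n] _ a I; rewrite /chain hk => ca Iint cI.
(* Any base point other than [a ord0] serves for the first move. It is removed from [I ord0] because
   targets must lie above it. *)
have [o o_a0] := lt_rot_no_max (a ord0) (a ord0).
have lo : lt_rot o o (a ord0).
  by rewrite /lt_rot eqxx eq_sym (lt_rot_neq o_a0) orbT.
have [||g [Gg mg gfix] [Iga _]] := orbit_dense (lt_rot_total o)
    (@lt_rot_dense o) GM GV G1 (br o) (U := I ord0 `&` [set y | y != o]) lo.
- have [p [q [pq pqI]]] := circ_interval_thick o (Iint ord0).
  exists p, q; split=> // y py yq; split; first exact: pqI.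
  exact: lt_rot_neq py.
- by move=> y [_ yo]; rewrite /lt_rot eqxx yo orbT.
have {}mg x y w : Cr (g x) (g y) (g w) = Cr x y w.
  have [u uu] := lt_rot_no_max o o; have [v uv] := lt_rot_no_max o u.
  apply: (circ_mono (aG _ Gg) (Cr_of_rot uu uv)).
  by apply: (@Cr_of_rot _ _ o); rewrite mg.
have cga : Cr_seq (g \o a).
  split=> [n2 i j ij /=|i j l ij jl] /=; last by rewrite mg; exact: ca.2.
  by move=> /(bij_inj (aG _ Gg).1); exact: ca.1.
(* Recutting at the placed point makes it least, hence fixed by all later movers; the remaining
   points and intervals form linear chains above it. *)
pose o' := g (a ord0).
have inlt i j : (i < j)%N -> (j < n)%N ->
    ((inord i.+1 : 'I_n.+1) < (inord j.+1 : 'I_n.+1))%N.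
  by move=> ij jn; rewrite !inordK // ltnS (ltn_trans ij).
have ingt i : (i < n)%N -> ((ord0 : 'I_n.+1) < (inord i.+1 : 'I_n.+1))%N.
  by move=> ni; rewrite inordK.
have [|||||h [Gh _ hfix] Uh] := orbit_dense_seq (lt_rot_total o')
    (@lt_rot_dense o') GM GV G1 (br o') (n := n) (z := o')
    (a := fun i => g (a (inord i.+1))) (U := fun i => I (inord i.+1)).
- by move=> i ni; apply: (Cr_seq_lt_rot cga); exact: ingt.
- by move=> i j ij jn; apply: (Cr_seq_lt_rot cga); exact: inlt.
- by move=> i ni; exact: circ_interval_thick.
- move=> i y ni Iy.
  have [s []] := interval_chain_pick2 cI (neq_ltn_ord (ingt _ ni)) Iga Iy.
  rewrite /chain hk => cs s0 <-; rewrite /o' -s0.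
  exact: Cr_seq_lt_rot (ingt _ ni).
(* Including [o'] as the selected point of [I ord0] turns circular order into order for the cut. *)
- move=> i j x y ij jn Ix Iy; have ni := ltn_trans ij jn.
  have [s []] := interval_chain_pick3 cI (neq_ltn_ord (ingt _ ni))
    (neq_ltn_ord (ingt _ jn)) (neq_ltn_ord (inlt _ _ ij jn)) Iga Ix Iy.
  rewrite /chain hk => cs s0 <- <-; rewrite /o' -s0.
  exact: Cr_seq_lt_rot (inlt _ _ ij jn).
exists (h \o g); first exact: GM.
case=> -[|i] ni.
  rewrite (_ : Ordinal ni = ord0); last exact: val_inj.
  by rewrite /= hfix // (sto_irr (lt_rot_total o')).
have := Uh i ni; rewrite (_ : inord i.+1 = Ordinal ni) //.
by apply: val_inj; rewrite /= inordK.
Qed.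

End CircularCase.

Theorem theorem12p2 (d : Order.disp_t) (L : orderType d) (k : kind)
    (G : set (L -> L)) (hG : nearly_ordered k G)
    (hb : exists g, [/\ G g, g <> id & bounded_perm k g]) :
  (k = Linear \/ k = Monotonic ->
     (interval_transitive k 3 G -> highly_approx_o_transitive k G) /\
     (dedekind_complete k L -> approx_o_transitive k 2 G ->
        highly_approx_o_transitive k G)) /\
  (k = Circular \/ k = Monocircular ->
     (interval_transitive k 4 G -> highly_approx_o_transitive k G) /\
     (dedekind_complete k L -> approx_o_transitive k 3 G ->
        highly_approx_o_transitive k G)).
Proof.
split=> kE.
  have hk : circ k = false by case: kE => ->.
  split=> [h3|hc h2]; apply: (linear_highly hk hG).
    exact: (linear_breaks_interval hk hG hb).
  exact: (linear_breaks_complete hk hG hb).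
have hk : circ k by case: kE => ->.
split=> [h4|hc h3]; apply: (circ_highly hk hG hb) => o.
  exact: (circ_breaks_interval hk hG hb).
exact: (circ_breaks_complete hk hG hb).
Qed.
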